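(* Let $\mathbb{F}$ be a finite field. Then the conjugacy problem in the group $\mathrm{GL}(2,\mathbb{F}[x])$ is effectively solvable: there is an algorithm which, given two matrices $A, B \in \mathrm{GL}(2,\mathbb{F}[x])$, decides whether or not there is $U\in \mathrm{GL}(2,\mathbb{F}[x])$ with $B=UAU^{-1}$.
   Context: $\mathrm{GL}(2,\mathbb{F}[x])$ is the group of invertible $2\times2$ matrices over the polynomial ring $\mathbb{F}[x]$. Matrices are given to the algorithm by the coefficient lists of their entries. *)

(* Defs.v *)
From HB Require Import structures.
From mathcomp Require Import all_boot all_order all_algebra.

Set Implicit Arguments.
Unset Strict Implicit.
Unset Printing Implicit Defensive.

Import GRing.Theory.
Local Open Scope ring_scope.

(* The model of computation: Kleene's partial recursive functions.
   [recfun n] is the syntax of n-ary mu-recursive function definitions. *)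
Inductive recfun : nat -> Type :=
| RZero n : recfun n
| RSucc : recfun 1
| RProj n (i : 'I_n) : recfun n
| RComp m n (f : recfun m) (g : 'I_m -> recfun n) : recfun n
| RPrec n (f : recfun n) (g : recfun n.+2) : recfun n.+1
| RMu n (f : recfun n.+1) : recfun n.

(* [computes f v y]: on input [v], the partial function denoted by [f] is
   defined and has value [y].
     RPrec f g :  h(0, v) = f(v),  h(k + 1, v) = g(k, h(k, v), v);
     RMu f     :  the least y such that f(y, v) = 0, where f(z, v) must be
                  defined for every z < y. *)
Fixpoint computes n (f : recfun n) : n.-tuple nat -> nat -> Prop :=
  match f in recfun n return n.-tuple nat -> nat -> Prop with
  | RZero _ => fun _ y => y = 0%N
  | RSucc => fun v y => y = (thead v).+1
  | RProj _ i => fun v y => y = tnth v i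
  | RComp m _ f g => fun v y =>
      exists2 w : m.-tuple nat,
        forall i, computes (g i) v (tnth w i) & computes f w y
  | RPrec _ f g => fun v =>
      (fix h (k : nat) : nat -> Prop :=
         if k is k'.+1 then fun y =>
           exists2 z, h k' z & computes g [tuple of k' :: z :: behead_tuple v] y
         else computes f (behead_tuple v)) (thead v)
  | RMu _ f => fun v y =>
      computes f [tuple of y :: v] 0 /\
      forall z, (z < y)%N -> exists t, computes f [tuple of z :: v] t.+1
  end.

Lemma computes_functional n (f : recfun n) v y z :
  computes f v y -> computes f v z -> y = z.
Proof.
elim: n / f v y z => [n|| n i | m n f IHf g IHg | n f IHf g IHg | n f IHf] v y z /=.
- by move=> -> ->.
- by move=> -> ->.
- by move=> -> ->.
- case=> w1 gw1 fw1 [w2 gw2 fw2].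
  have eqw : w1 = w2.
    by apply: eq_from_tnth => i; apply: IHg (gw1 i) (gw2 i).
  by apply: IHf fw1 _; rewrite eqw.
- elim: (thead v) y z => [|k IHk] y z; first exact: IHf.
  by case=> s hs gs [t ht gt]; rewrite (IHk _ _ hs ht) in gs; apply: IHg gs gt.
- case=> fy ly [fz lz]; case: (ltngtP y z) => // lt.
  + by have [t ft] := lz _ lt; have := IHf _ _ _ fy ft.
  + by have [t ft] := ly _ lt; have := IHf _ _ _ fz ft.
Qed.

(* The promise [D] restricts the inputs on which the program must answer;
   [code x] is the presentation of the instance [x]. *)
Definition decides_on (T : Type) (D P : T -> Prop) n
    (code : T -> n.-tuple nat) (f : recfun n) : Prop :=
  forall x, D x ->
    (P x -> computes f (code x) 1) /\ (~ P x -> computes f (code x) 0).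

Definition effectively_solvable (T : Type) (D P : T -> Prop) n
    (code : T -> n.-tuple nat) : Prop :=
  exists f : recfun n, decides_on D P code f.

Section ConjugacyGL2.
Variable F : finFieldType.

(* A polynomial is presented by its coefficient list, from the constant to the
   leading coefficient (empty for 0); each coefficient is replaced by its
   number in {0, ..., #|F| - 1}, and the list of numbers by its Goedel number.*)
Definition poly_code (p : {poly F}) : nat :=
  CodeSeq.code [seq (enum_rank a : nat) | a <- p].

Definition pair_code (AB : 'M[{poly F}]_2 * 'M[{poly F}]_2) : 8.-tuple nat :=
  let: (A, B) := AB in
  [tuple poly_code (A 0 0); poly_code (A 0 1);
         poly_code (A 1 0); poly_code (A 1 1);
         poly_code (B 0 0); poly_code (B 0 1);
         poly_code (B 1 0); poly_code (B 1 1)].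

Definition in_GL2 (AB : 'M[{poly F}]_2 * 'M[{poly F}]_2) : Prop :=
  AB.1 \in unitmx /\ AB.2 \in unitmx.

Definition conj_GL2 (AB : 'M[{poly F}]_2 * 'M[{poly F}]_2) : Prop :=
  exists2 U : 'M[{poly F}]_2, U \in unitmx & AB.2 = U *m AB.1 *m invmx U.

End ConjugacyGL2.

(* Main.v *)
Require Import Defs.
From mathcomp Require Import all_boot all_order all_algebra.
From mathcomp Require Import perm zify ring.

(** Why conjugacy in GL(2, F[x]) is decidable.

    Say that a matrix is bounded by N when its four entries have size at most
    N (degree below N).  Over a finite field, finitely many matrices are
    bounded by N.  The key fact is that if A and B are conjugate and both
    bounded by N, then a conjugation from A to B can be split into elementary
    steps (conjugation by a constant matrix or by a transvection
    [1, p; 0, 1]), all of whose intermediate matrices are still bounded by N.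
    This is a peak reduction, [peak_reduction]: Euclid's algorithm writes the
    conjugator, up to constant factors, as [1, p; 0, 1] * W with W of smaller
    degree.  If the matrix C between the two factors had larger degree than both
    ends, comparing leading coefficients on the two sides would kill the leading
    coefficient of every entry of C.  Geometrically, the degree of a conjugate of A is a convex
    function on the Bruhat-Tits tree of F((1/x)), so along a geodesic it never
    exceeds its values at the two ends.

    A transvection between two matrices bounded by N either is itself bounded
    in terms of N or acts trivially ([chain_elem]).  Hence conjugacy of A and B
    is connectedness in an explicit finite graph, and a path without
    repetitions yields a conjugator whose degree is bounded by an explicit
    function of N and #|F| ([conj_by_bound]).

    The algorithm searches below the corresponding bound on codes for a pair
    (U, V) with UV = 1 and B = UAV.  It remains to program this search with
    mu-recursive functions.  Functions of an input of arbitrary type are called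
    computable relative to a presentation of the input by a tuple of numbers;
    a bound variable is one more component of the input.  Polynomial-valued
    functions are handled through their coefficients: the n-th coefficient has
    to be computable as a function of n and of the input, as well as a bound on
    the size.  This class is closed under sums and products, has decidable
    equality, and contains the decoding of Goedel numbers. *)

Set Implicit Arguments.
Unset Strict Implicit.
Unset Printing Implicit Defensive.

Import GRing.Theory.

(** * Functions computable relative to a presentation of the input *)

Definition computable (T : Type) n (env : T -> n.-tuple nat) (f : T -> nat) :=
  exists r : recfun n, forall x, computes r (env x) (f x).

(** The presentation of an input extended with one bound variable. *)
Definition push (T : Type) n (env : T -> n.-tuple nat) (p : nat * T) :
  n.+1.-tuple nat := [tuple of p.1 :: env p.2].

Definition computable_map (T T' : Type) n n' (env : T -> n.-tuple nat)
    (env' : T' -> n'.-tuple nat) (h : T' -> T) :=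
  forall i, computable env' (fun y => tnth (env (h y)) i).

Lemma eq_computable T n (env : T -> n.-tuple nat) f g :
  f =1 g -> computable env f -> computable env g.
Proof. by move=> fg [r rf]; exists r => x; rewrite -fg. Qed.

Lemma computes_val n (r : recfun n) (v w : n.-tuple nat) y :
  v = w :> seq nat -> computes r v y -> computes r w y.
Proof. by move/val_inj->. Qed.

Lemma computes_prec n (f : recfun n) g (v : n.-tuple nat) k (h : nat -> nat) :
  computes f v (h 0) ->
  (forall i, computes g [tuple of i :: h i :: v] (h i.+1)) ->
  computes (RPrec f g) [tuple of k :: v] (h k).
Proof.
move=> f0 gS; cbn [computes]; rewrite theadE.
(* the recursion clause of [computes] mentions the tail of the argument tuple;
   it has to become [v] before the induction on [k], which changes the head *)
have : behead_tuple [tuple of k :: v] = v by apply: val_inj.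
move: (behead_tuple _) => w ->; elim: k => [|k IH]; first exact: f0.
by exists (h k); [exact: IH | exact: gS].
Qed.

(** Substitution; weakening, exchange and instantiation of bound variables are
    the cases where [h] only rearranges or computes components. *)
Lemma computable_comp T T' n n' (env : T -> n.-tuple nat)
    (env' : T' -> n'.-tuple nat) f h :
  computable env f -> computable_map env env' h ->
  computable env' (fun y => f (h y)).
Proof.
move=> [r rf] /fin_all_exists[g rg]; exists (RComp r g) => y /=.
by exists (env (h y)) => // i; apply: rg.
Qed.

Lemma computable_map_id T n (env : T -> n.-tuple nat) :
  computable_map env env id.
Proof. by move=> i; exists (RProj i). Qed.

Lemma computable_map_push T T' n n' (env : T -> n.-tuple nat)
    (env' : T' -> n'.-tuple nat) a h :
  computable env' a -> computable_map env env' h ->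
  computable_map (push env) env' (fun y => (a y, h y)).
Proof.
move=> ca ch i; case: (unliftP ord0 i) => [j|] ->.
  by apply: eq_computable (ch j) => y; rewrite tnthS.
by apply: eq_computable ca => y; rewrite tnth0.
Qed.

Lemma computable_map_snd T T' n n' (env : T -> n.-tuple nat)
    (env' : T' -> n'.-tuple nat) h :
  computable_map env env' h ->
  computable_map env (push env') (fun p => h p.2).
Proof.
move=> ch i; have [r rh] := ch i.
exists (RComp r (fun j => RProj (lift ord0 j))) => p /=.
by exists (env' p.2) => // j; rewrite tnthS.
Qed.

Lemma computable_fst T n (env : T -> n.-tuple nat) :
  computable (push env) fst.
Proof. by exists (RProj ord0) => p /=; rewrite tnth0. Qed.

Lemma computable_snd T n (env : T -> n.-tuple nat) f :
  computable env f -> computable (push env) (fun p => f p.2).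
Proof.
move=> cf; apply: (computable_comp cf).
exact: computable_map_snd (@computable_map_id _ _ _).
Qed.

Lemma computable_let T n (env : T -> n.-tuple nat) (h : nat * T -> nat) f :
  computable (push env) h -> computable env f ->
  computable env (fun x => h (f x, x)).
Proof.
move=> ch cf; apply: (computable_comp ch).
exact: computable_map_push (@computable_map_id _ _ _).
Qed.

Lemma computable_succ T n (env : T -> n.-tuple nat) f :
  computable env f -> computable env (fun x => (f x).+1).
Proof.
move=> [r rf]; exists (RComp RSucc (fun=> r)) => x /=.
by exists [tuple f x] => // i; rewrite (ord1 i) tnth0.
Qed.

Lemma computable_const T n (env : T -> n.-tuple nat) m : computable env (fun=> m).
Proof. by elim: m => [|m IH]; [exists (RZero n) | apply: computable_succ]. Qed.

(** Primitive recursion, with the counter and the accumulator as the two bound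
    variables of the step [s]. *)
Lemma computable_iteri T n (env : T -> n.-tuple nat) k z
    (s : nat * (nat * T) -> nat) :
  computable env k -> computable env z -> computable (push (push env)) s ->
  computable env
    (fun x => iteri (k x) (fun i acc => s (i, (acc, x))) (z x)).
Proof.
move=> ck [rz cz] [rs cs].
apply: (@computable_let _ _ env
  (fun p => iteri p.1 (fun i acc => s (i, (acc, p.2))) (z p.2))) ck.
exists (RPrec rz rs) => -[m x].
apply: (@computes_prec _ rz rs (env x) m
  (fun m => iteri m (fun i acc => s (i, (acc, x))) (z x))) => [|i].
  exact: cz.
by have := cs (i, (iteri i (fun i acc => s (i, (acc, x))) (z x), x));
  apply: computes_val.
Qed.

(** * Arithmetic, bounded quantifiers and minimization *)

Lemma computable_acc T n (env : T -> n.-tuple nat) :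
  computable (push (push env)) (fun p => p.2.1).
Proof. exact/computable_snd/computable_fst. Qed.

Lemma computable_snd2 T n (env : T -> n.-tuple nat) f :
  computable env f -> computable (push (push env)) (fun p => f p.2.2).
Proof. by move=> cf; apply: computable_snd (computable_snd cf). Qed.

Lemma computable_add T n (env : T -> n.-tuple nat) f g :
  computable env f -> computable env g -> computable env (fun x => f x + g x).
Proof.
move=> cf cg; apply: (eq_computable _ (@computable_iteri _ _ _ f g
    (fun p => p.2.1.+1) cf cg (computable_succ (computable_acc env)))).
by move=> x /=; elim: (f x) => //= m ->.
Qed.

Lemma computable_mul T n (env : T -> n.-tuple nat) f g :
  computable env f -> computable env g -> computable env (fun x => f x * g x).
Proof.
move=> cf cg; apply: (eq_computable _ (@computable_iteri _ _ _ f (fun=> 0)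
    (fun p => p.2.1 + g p.2.2) cf (computable_const _ 0)
    (computable_add (computable_acc _) (computable_snd2 cg)))).
by move=> x /=; elim: (f x) => //= m ->; lia.
Qed.

Lemma computable_pred T n (env : T -> n.-tuple nat) f :
  computable env f -> computable env (fun x => (f x).-1).
Proof.
move=> cf; apply: (eq_computable _ (@computable_iteri _ _ _ f (fun=> 0)
    (fun p => p.1) cf (computable_const _ 0) (computable_fst _))).
by move=> x /=; case: (f x).
Qed.

Lemma computable_exp T n (env : T -> n.-tuple nat) f g :
  computable env f -> computable env g -> computable env (fun x => f x ^ g x).
Proof.
move=> cf cg; apply: (eq_computable _ (@computable_iteri _ _ _ g (fun=> 1)
    (fun p => p.2.1 * f p.2.2) cg (computable_const _ 1)
    (computable_mul (computable_acc _) (computable_snd2 cf)))).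
by move=> x /=; elim: (g x) => //= m ->; rewrite expnSr.
Qed.

Lemma computable_sub T n (env : T -> n.-tuple nat) f g :
  computable env f -> computable env g -> computable env (fun x => f x - g x).
Proof.
move=> cf cg; apply: (eq_computable _ (@computable_iteri _ _ _ g f
    (fun p => p.2.1.-1) cg cf (computable_pred (computable_acc _)))).
by move=> x /=; elim: (g x) => /= [|m ->]; lia.
Qed.

Lemma computable_leq T n (env : T -> n.-tuple nat) f g :
  computable env f -> computable env g ->
  computable env (fun x => (f x <= g x)%N : nat).
Proof.
move=> cf cg; apply: (eq_computable (f := fun x => 1 - (f x - g x))).
  by move=> x; case: leqP; lia.
by apply: computable_sub (computable_const _ 1) (computable_sub cf cg).
Qed.

Lemma computable_and T n (env : T -> n.-tuple nat) (c d : T -> bool) :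
  computable env c -> computable env d -> computable env (fun x => c x && d x).
Proof.
move=> cc cd; apply: eq_computable (computable_mul cc cd) => x.
by rewrite mulnb.
Qed.

Lemma computable_neg T n (env : T -> n.-tuple nat) (c : T -> bool) :
  computable env c -> computable env (fun x => ~~ c x).
Proof.
move=> cc; apply: eq_computable (computable_sub (computable_const _ 1) cc) => x.
by case: (c x).
Qed.

Lemma computable_if T n (env : T -> n.-tuple nat) (c : T -> bool) f g :
  computable env c -> computable env f -> computable env g ->
  computable env (fun x => if c x then f x else g x).
Proof.
move=> cc cf cg; apply: eq_computable (computable_add
    (computable_mul cc cf) (computable_mul (computable_neg cc) cg)) => x.
by case: (c x); rewrite /= ?mul1n ?mul0n ?addn0.
Qed.

Lemma computable_eq T n (env : T -> n.-tuple nat) (f g : T -> nat) :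
  computable env f -> computable env g -> computable env (fun x => f x == g x).
Proof.
move=> cf cg; apply: eq_computable
  (computable_and (computable_leq cf cg) (computable_leq cg cf)) => x.
by rewrite eqn_leq.
Qed.

Lemma computable_all T n (env : T -> n.-tuple nat) k (P : nat * T -> bool) :
  computable env k -> computable (push env) P ->
  computable env (fun x => all (fun i => P (i, x)) (iota 0 (k x))).
Proof.
move=> ck cP.
have cP' : computable (push (push env)) (fun p => P (p.1, p.2.2)).
  apply: (computable_comp cP); apply: computable_map_push (computable_fst _) _.
  exact: computable_map_snd (computable_map_snd (@computable_map_id _ _ env)).
apply: (eq_computable _ (@computable_iteri _ _ _ k (fun=> 1)
  (fun p => p.2.1 * P (p.1, p.2.2)) ck (computable_const _ 1)
  (computable_mul (computable_acc _) cP'))) => x /=.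
elim: (k x) => // m IH; rewrite iteriS IH -[m.+1]addn1 iotaD all_cat mulnb.
by rewrite /= andbT.
Qed.

Lemma computable_has T n (env : T -> n.-tuple nat) k (P : nat * T -> bool) :
  computable env k -> computable (push env) P ->
  computable env (fun x => has (fun i => P (i, x)) (iota 0 (k x))).
Proof.
move=> ck cP; apply: eq_computable
  (computable_neg (computable_all ck (computable_neg cP))) => x.
by rewrite -has_predC /=; congr nat_of_bool; apply: eq_has => i /=; rewrite negbK.
Qed.

(** A total function is found from its decidable graph by unbounded search; this
    spares programming inverse functions such as the decoding of lists. *)
Lemma computable_graph T n (env : T -> n.-tuple nat) (P : nat * T -> bool) g :
  computable (push env) P -> (forall y x, P (y, x) = (y == g x)) ->
  computable env g.
Proof.
move=> /computable_neg[r rP] Pg; exists (RMu r) => x /=; split=> [|z lt_z].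
  by have := rP (g x, x); rewrite Pg eqxx.
by exists 0; have := rP (z, x); rewrite Pg ltn_eqF.
Qed.

Lemma computable_sum T n (env : T -> n.-tuple nat) (I : Type) (s : seq I)
    (G : I -> T -> nat) :
  (forall a, computable env (G a)) ->
  computable env (fun x => \sum_(a <- s) G a x).
Proof.
move=> cG; elim: s => [|a s IH].
  by apply: eq_computable (computable_const env 0) => x; rewrite big_nil.
by apply: eq_computable (computable_add (cG a) IH) => x; rewrite big_cons.
Qed.

(** * Decoding lists of numbers *)

Lemma code_cons h t : 2 ^ h * t.*2.+1 = CodeSeq.code (h :: CodeSeq.decode t).
Proof. by rewrite /= CodeSeq.decodeK. Qed.

Lemma code_eq0 s : (CodeSeq.code s == 0) = (s == [::]).
Proof. by case: s => //= a s; rewrite muln_eq0 expn_eq0. Qed.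

(** The head and the tail of a list are bounded by its code, so their graphs are
    described by bounded quantifiers. *)
Lemma code_behead_graph y m :
  (y == CodeSeq.code (behead (CodeSeq.decode m))) =
  if m == 0 then y == 0 else has (fun h => 2 ^ h * y.*2.+1 == m) (iota 0 m).
Proof.
rewrite -{2 3 4}[m]CodeSeq.decodeK code_eq0; case: (CodeSeq.decode m) => //= a s.
apply/eqP/hasP => [->|[h _ /eqP]].
  exists a; last by [].
  by rewrite mem_iota; have /= /andP[] := CodeSeq.ltn_code (a :: s).
rewrite !code_cons => /(can_inj CodeSeq.codeK)[_].
exact: (can_inj CodeSeq.decodeK).
Qed.

Lemma code_head_graph y m :
  (y == head 0 (CodeSeq.decode m)) =
  if m == 0 then y == 0 else has (fun t => 2 ^ y * t.*2.+1 == m) (iota 0 m).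
Proof.
rewrite -{2 3 4}[m]CodeSeq.decodeK code_eq0; case: (CodeSeq.decode m) => //= a s.
apply/eqP/hasP => [->|[t _ /eqP]].
  exists (CodeSeq.code s); last by [].
  rewrite mem_iota /=; apply: (@leq_trans (CodeSeq.code s).*2.+1).
    by rewrite ltnS -addnn leq_addr.
  by rewrite leq_pmull ?expn_gt0.
by rewrite !code_cons => /(can_inj CodeSeq.codeK)[].
Qed.

Lemma computable_code_behead T n (env : T -> n.-tuple nat) m :
  computable env m ->
  computable env (fun x => CodeSeq.code (behead (CodeSeq.decode (m x)))).
Proof.
move=> cm; pose cm1 := computable_snd cm; pose c0 := @computable_const.
apply: (@computable_graph _ _ _ (fun p => if m p.2 == 0 then p.1 == 0 else
  has (fun h => 2 ^ h * p.1.*2.+1 == m p.2) (iota 0 (m p.2)))) => [|y x].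
  have cf := computable_fst env; have cf' := computable_fst (push env).
  have H : computable (push (push env))
      (fun p => 2 ^ p.1 * (p.2.1 + p.2.1).+1 == m p.2.2).
    apply: computable_eq (computable_snd cm1).
    apply: computable_mul (computable_exp (c0 _ _ _ 2) cf') _.
    by apply: computable_succ (computable_add _ _); apply: computable_acc.
  apply: eq_computable (computable_if (computable_eq cm1 (c0 _ _ _ 0))
    (computable_eq cf (c0 _ _ _ 0)) (computable_has cm1 H)) => p.
  by case: ifP => // _; under eq_has do rewrite /= addnn.
by rewrite code_behead_graph.
Qed.

Lemma computable_code_head T n (env : T -> n.-tuple nat) m :
  computable env m ->
  computable env (fun x => head 0 (CodeSeq.decode (m x))).
Proof.
move=> cm; pose cm1 := computable_snd cm; pose c0 := @computable_const.
apply: (@computable_graph _ _ _ (fun p => if m p.2 == 0 then p.1 == 0 else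
  has (fun t => 2 ^ p.1 * t.*2.+1 == m p.2) (iota 0 (m p.2)))) => [|y x].
  have cf := computable_fst env; have cf' := computable_fst (push env).
  have H : computable (push (push env))
      (fun p => 2 ^ p.2.1 * (p.1 + p.1).+1 == m p.2.2).
    apply: computable_eq (computable_snd cm1).
    apply: computable_mul (computable_exp (c0 _ _ _ 2) (computable_acc _)) _.
    exact: computable_succ (computable_add cf' cf').
  apply: eq_computable (computable_if (computable_eq cm1 (c0 _ _ _ 0))
    (computable_eq cf (c0 _ _ _ 0)) (computable_has cm1 H)) => p.
  by case: ifP => // _; under eq_has do rewrite /= addnn.
by rewrite code_head_graph.
Qed.

Lemma computable_nth_decode T n (env : T -> n.-tuple nat) d (m k : T -> nat) :
  computable env m -> computable env k ->
  computable env (fun x => nth d (CodeSeq.decode (m x)) (k x)).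
Proof.
move=> cm ck; pose cdrop x := CodeSeq.code (drop (k x) (CodeSeq.decode (m x))).
have cc : computable env cdrop.
  apply: (eq_computable _ (@computable_iteri _ _ _ k m
    (fun p => CodeSeq.code (behead (CodeSeq.decode p.2.1))) ck cm
    (computable_code_behead (computable_acc _)))) => x.
  rewrite /cdrop; elim: (k x) => [|i IH]; first by rewrite drop0 CodeSeq.decodeK.
  by rewrite iteriS IH CodeSeq.codeK -drop1 drop_drop add1n.
(* past the end of the list the remaining code is 0 and the default is due *)
apply: eq_computable (computable_if (computable_eq cc (computable_const _ 0))
  (computable_const _ d) (computable_code_head cc)) => x.
rewrite /cdrop code_eq0 CodeSeq.codeK -[in RHS](addn0 (k x)) -nth_drop.
by case: (drop _ _).
Qed.

(** * Values in a finite type *)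

Section Finite.
Variable E : finType.

Definition fin_computable T n (env : T -> n.-tuple nat) (f : T -> E) :=
  computable env (fun x => enum_rank (f x)).

(** A function of an element of a finite type is a finite table, here written as
    a sum of indicators. *)
Lemma computable_fin T n (env : T -> n.-tuple nat) (f : T -> E)
    (h : E -> T -> nat) :
  fin_computable env f -> (forall a, computable env (h a)) ->
  computable env (fun x => h (f x) x).
Proof.
move=> cf ch; apply: eq_computable (computable_sum (index_enum E) (fun a =>
  computable_mul (computable_eq cf (computable_const env (enum_rank a)))
  (ch a))) => x.
rewrite (bigD1 (f x)) //= eqxx mul1n big1 ?addn0 // => a ne_a.
case: eqP => //= /val_inj/enum_rank_inj fa.
by rewrite fa eqxx in ne_a.
Qed.

Variables (T : Type) (n : nat) (env : T -> n.-tuple nat).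

Lemma fin_computable_op (op : E -> E -> E) f g :
  fin_computable env f -> fin_computable env g ->
  fin_computable env (fun x => op (f x) (g x)).
Proof.
move=> cf cg.
apply: (computable_fin (h := fun a x => enum_rank (op a (g x))) cf) => a.
apply: (computable_fin (h := fun b _ => enum_rank (op a b)) cg) => b.
exact: computable_const.
Qed.

Lemma fin_computable_nth (a0 : E) k :
  computable env k -> fin_computable env (fun x => nth a0 (enum E) (k x)).
Proof.
move=> ck; apply: eq_computable (computable_if
  (computable_leq (computable_succ ck) (computable_const _ #|E|))
  ck (computable_const _ (enum_rank a0))) => x.
case: ltnP => [lt_kE | le_Ek]; last by rewrite nth_default // -cardE.
by rewrite -[k x]/(nat_of_ord (Ordinal lt_kE)) -enum_val_nth enum_valK.
Qed.

End Finite.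

(** * Two by two matrices *)

Section TwoByTwo.
Local Open Scope ring_scope.

Lemma ord2P (P : 'I_2 -> Prop) : P 0 -> P 1 -> forall i, P i.
Proof.
move=> P0 P1 [[|[|i]] lti] //.
  by rewrite (_ : Ordinal lti = 0) //; apply: val_inj.
by rewrite (_ : Ordinal lti = 1) //; apply: val_inj.
Qed.

Lemma mulmx2E (R : comNzRingType) (A B : 'M[R]_2) i j :
  (A *m B) i j = A i 0 * B 0 j + A i 1 * B 1 j.
Proof.
rewrite mxE !big_ord_recl big_ord0 addr0.
by rewrite (_ : lift 0 0 = 1) //; apply: val_inj.
Qed.

Lemma mx2P (R : Type) (A B : 'M[R]_2) :
  A 0 0 = B 0 0 -> A 0 1 = B 0 1 -> A 1 0 = B 1 0 -> A 1 1 = B 1 1 -> A = B.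
Proof. by move=> *; apply/matrixP; do 2!apply: ord2P. Qed.

End TwoByTwo.

(** * Polynomial and matrix valued functions *)

Section Poly.
Variable F : finFieldType.
Local Open Scope ring_scope.

Lemma fin_computable_sum T n (env : T -> n.-tuple nat) k (G : nat * T -> F) :
  computable env k -> fin_computable (push env) G ->
  fin_computable env (fun x => \sum_(j < k x) G (j : nat, x)).
Proof.
move=> ck cG.
have cG' : fin_computable (push (push env)) (fun p => G (p.1, p.2.2)).
  apply: (computable_comp cG); apply: computable_map_push (computable_fst _) _.
  exact: computable_map_snd (computable_map_snd (@computable_map_id _ _ env)).
have cacc := fin_computable_nth (0 : F) (computable_acc env).
apply: (eq_computable _ (@computable_iteri _ _ _ k (fun=> enum_rank (0 : F))
  (fun p => enum_rank (nth 0 (enum F) p.2.1 + G (p.1, p.2.2))) ck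
  (computable_const _ _) (fin_computable_op _ cacc cG'))) => x.
elim: (k x) => [|m IH]; first by rewrite big_ord0.
by rewrite iteriS IH big_ord_recr nth_enum_rank.
Qed.

(** Working with coefficients rather than with codes makes ring operations easy
    to program; the bound on the size keeps comparisons finite. *)
Definition poly_computable T n (env : T -> n.-tuple nat) (P : T -> {poly F}) :=
  (exists2 s : T -> nat, computable env s & forall x, (size (P x) <= s x)%N) /\
  fin_computable (push env) (fun p => (P p.2)`_p.1).

Lemma poly_computable_comp T T' n n' (env : T -> n.-tuple nat)
    (env' : T' -> n'.-tuple nat) P h :
  poly_computable env P -> computable_map env env' h ->
  poly_computable env' (fun y => P (h y)).
Proof.
move=> [[s cs Ps] cP] ch; split.
  by exists (fun y => s (h y)); first apply: (computable_comp cs).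
apply: (computable_comp cP (h := fun p => (p.1, h p.2))).
exact: computable_map_push (computable_fst _) (computable_map_snd ch).
Qed.

Section Ops.
Variables (T : Type) (n : nat) (env : T -> n.-tuple nat).
Implicit Types P Q : T -> {poly F}.

Lemma poly_computable_snd P :
  poly_computable env P -> poly_computable (push env) (fun p => P p.2).
Proof.
move=> cP; apply: (poly_computable_comp cP).
exact: computable_map_snd (@computable_map_id _ _ env).
Qed.

Lemma poly_computable_coef P k :
  poly_computable env P -> computable env k ->
  fin_computable env (fun x => (P x)`_(k x)).
Proof. by move=> [_ cP] ck; have := computable_let cP ck. Qed.

Lemma eq_poly_computable P Q :
  P =1 Q -> poly_computable env P -> poly_computable env Q.
Proof.
move=> PQ [[s cs Ps] cP]; split; first by exists s => // x; rewrite -PQ.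
by apply: eq_computable cP => p; rewrite PQ.
Qed.

Lemma poly_computableC a : poly_computable env (fun=> a%:P).
Proof.
split.
  exists (fun=> 1%N) => [|x]; first exact: computable_const.
  exact: size_polyC_leq1.
apply: eq_computable (computable_if
  (computable_eq (computable_fst _) (computable_const _ 0%N))
  (computable_const _ (enum_rank a)) (computable_const _ (enum_rank (0 : F)))) => p.
by rewrite coefC; case: ifP.
Qed.

Lemma poly_computableD P Q :
  poly_computable env P -> poly_computable env Q ->
  poly_computable env (fun x => P x + Q x).
Proof.
move=> [[s cs Ps] cP] [[t ct Qt] cQ]; split.
  exists (fun x => s x + t x)%N; first exact: computable_add.
  move=> x; apply: leq_trans (size_polyD _ _) _; rewrite geq_max.
  by rewrite (leq_trans (Ps x)) ?(leq_trans (Qt x)) ?leq_addl ?leq_addr.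
apply: (eq_computable _ (fin_computable_op (fun a b => a + b) cP cQ)) => p.
by rewrite coefD.
Qed.

Lemma computable_poly_eq P Q :
  poly_computable env P -> poly_computable env Q ->
  computable env (fun x => P x == Q x).
Proof.
move=> [[s cs Ps] cP] [[t ct Qt] cQ].
apply: eq_computable (computable_all (computable_add cs ct)
  (computable_eq cP cQ)) => x /=; congr nat_of_bool.
apply/allP/eqP => [PQ | -> //]; apply/polyP => i.
have [lt_i | le_i] := ltnP i (s x + t x).
  have := PQ i; rewrite mem_iota => /(_ lt_i)/eqP/val_inj.
  exact: enum_rank_inj.
by rewrite !nth_default // (leq_trans _ le_i) // (leq_trans (Ps x), leq_trans (Qt x))
  ?leq_addl ?leq_addr.
Qed.

End Ops.

Section Mul.
Variables (T : Type) (n : nat) (env : T -> n.-tuple nat).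
Implicit Types P Q : T -> {poly F}.

Lemma poly_computableM P Q :
  poly_computable env P -> poly_computable env Q ->
  poly_computable env (fun x => P x * Q x).
Proof.
move=> cP cQ; split.
  have [[[s cs Ps] _] [[t ct Qt] _]] := (cP, cQ).
  exists (fun x => s x + t x)%N; first exact: computable_add.
  move=> x; apply: leq_trans (size_polyMleq _ _) _.
  by rewrite (leq_trans (leq_pred _)) // leq_add.
have cP2 := poly_computable_snd (poly_computable_snd cP).
have cQ2 := poly_computable_snd (poly_computable_snd cQ).
have ci := computable_fst (push env).
have cPj := poly_computable_coef cP2 ci.
have cQj := poly_computable_coef cQ2 (computable_sub (computable_acc env) ci).
have := fin_computable_sum (computable_succ (computable_fst env))
  (fin_computable_op (fun a b => a * b) cPj cQj).
by apply: eq_computable => p; rewrite coefM.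
Qed.

(** Total extension of the inverse of [poly_code].  Indices past the end of the
    list yield the number #|F|, which numbers no element of F, hence 0; the
    element 0 itself need not have number 0. *)
Definition poly_decode (m : nat) : {poly F} :=
  \poly_(i < m) nth 0 (enum F) (nth #|F| (CodeSeq.decode m) i).

Lemma size_decode m : (size (CodeSeq.decode m) <= m)%N.
Proof.
rewrite -{2}[m]CodeSeq.decodeK; elim: (CodeSeq.decode m) => //= a s IH.
rewrite (@leq_trans (CodeSeq.code s).*2.+1) ?leq_pmull ?expn_gt0 //.
by rewrite ltnS -addnn (leq_trans IH) ?leq_addr.
Qed.

Lemma poly_codeK : cancel (@poly_code F) poly_decode.
Proof.
move=> p; apply/polyP => i; rewrite coef_poly /poly_code CodeSeq.codeK.
set s := map _ _; have ss : size s = size p by rewrite size_map.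
have le_p : (size p <= CodeSeq.code s)%N.
  by rewrite -ss -{1}[s]CodeSeq.codeK size_decode.
have [lt_ip | le_pi] := ltnP i (size p).
  rewrite (leq_trans lt_ip le_p) [nth _ s i](nth_map 0) //.
  by rewrite nth_enum_rank.
rewrite [p`_i]nth_default // [nth _ s i]nth_default ?ss //.
by rewrite nth_default ?if_same // -cardE.
Qed.

Lemma poly_computable_decode m :
  computable env m -> poly_computable env (fun x => poly_decode (m x)).
Proof.
move=> cm; split; first by exists m => // x; apply: size_poly.
have cm1 := computable_snd cm; have ci := computable_fst env.
apply: eq_computable (computable_if (computable_leq (computable_succ ci) cm1)
  (fin_computable_nth (0 : F) (computable_nth_decode #|F| cm1 ci))
  (computable_const _ (enum_rank (0 : F)))) => p.
by rewrite coef_poly; case: ifP.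
Qed.

End Mul.

Section Matrix.
Variables (T : Type) (n : nat) (env : T -> n.-tuple nat).

Definition mx_computable (M : T -> 'M[{poly F}]_2) :=
  forall i j, poly_computable env (fun x => M x i j).

Lemma mx_computable1 : mx_computable (fun=> 1%:M).
Proof.
move=> i j; apply: eq_poly_computable (poly_computableC _ (i == j)%:R) => x.
by rewrite mxE; case: eqP.
Qed.

Lemma mx_computableM M N :
  mx_computable M -> mx_computable N -> mx_computable (fun x => M x *m N x).
Proof.
move=> cM cN i j.
apply: eq_poly_computable (poly_computableD
  (poly_computableM (cM i 0) (cN 0 j)) (poly_computableM (cM i 1) (cN 1 j))) => x.
by rewrite mulmx2E.
Qed.

Lemma computable_mx_eq M N :
  mx_computable M -> mx_computable N -> computable env (fun x => M x == N x).
Proof.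
move=> cM cN; have c i j := computable_poly_eq (cM i j) (cN i j).
apply: eq_computable (computable_and (computable_and (c 0 0) (c 0 1))
  (computable_and (c 1 0) (c 1 1))) => x; congr nat_of_bool.
apply/andP/eqP => [[/andP[/eqP e00 /eqP e01] /andP[/eqP e10 /eqP e11]] | ->].
  exact: mx2P.
by rewrite !eqxx.
Qed.

End Matrix.

Lemma mx_computable_snd T n (e : T -> n.-tuple nat) (M : T -> 'M[{poly F}]_2) :
  mx_computable e M -> mx_computable (push e) (fun p => M p.2).
Proof. by move=> cM i j; apply: poly_computable_snd (cM i j). Qed.

End Poly.

(** * Peak reduction for conjugation by a transvection *)

Section PeakReduction.
Local Open Scope ring_scope.
Variable K : fieldType.
Implicit Types (p q : {poly K}) (A B C U V W : 'M[{poly K}]_2).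

Lemma coef_top p q i j : (size p <= i.+1)%N -> (size q <= j.+1)%N ->
  (p * q)`_(i + j) = p`_i * q`_j.
Proof.
move=> sp sq; have lt_i : (i < (i + j).+1)%N by rewrite ltnS leq_addr.
rewrite coefM (bigD1 (Ordinal lt_i)) //=.
rewrite addKn big1 ?addr0 // => k /eqP ne_k.
have [lt_ki | le_ik] := ltnP k i.
  by rewrite [q`__]nth_default ?mulr0 // (leq_trans sq) //; lia.
rewrite [p`_k]nth_default ?mul0r // (leq_trans sp) // ltn_neqAle le_ik andbT.
by apply/eqP => ik; apply: ne_k; apply: val_inj.
Qed.

Lemma size_le_coef0 p i : (size p <= i.+1)%N -> p`_i = 0 -> (size p <= i)%N.
Proof.
move=> sp p0; apply/leq_sizeP => j; rewrite leq_eqVlt => /predU1P[<- // | lt_ij].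
by rewrite nth_default // (leq_trans sp).
Qed.

Lemma size_leqD p q n : (size p <= n)%N -> (size q <= n)%N -> (size (p + q)%R <= n)%N.
Proof. by move=> sp sq; rewrite (leq_trans (size_polyD _ _)) // geq_max sp. Qed.

Lemma size_leqB p q n : (size p <= n)%N -> (size q <= n)%N -> (size (p - q)%R <= n)%N.
Proof. by move=> sp sq; apply: size_leqD; rewrite ?size_polyN. Qed.

Lemma size_leqM p q a b c :
  (size p <= a.+1)%N -> (size q <= b)%N -> (a + b <= c)%N -> (size (p * q)%R <= c)%N.
Proof. by move=> sp sq sc; have := size_polyMleq p q; lia. Qed.

Lemma size_mul_cancel p q a b :
  size p = a.+1 -> (size (p * q)%R <= a + b)%N -> (size q <= b)%N.
Proof.
move=> sp; have p0 : p != 0 by rewrite -size_poly_eq0 sp.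
by have [-> | q0] := eqVneq q 0; rewrite ?size_poly0 // size_mul // sp addSn leq_add2l.
Qed.

Definition bounded n A := forall i j, (size (A i j) <= n)%N.

Definition elem p : 'M[{poly K}]_2 := 1%:M + p *: delta_mx 0 1.

Lemma elemE p : [/\ elem p 0 0 = 1, elem p 0 1 = p, elem p 1 0 = 0 & elem p 1 1 = 1].
Proof. by split; rewrite !mxE /= ?mulr0 ?mulr1 ?addr0 ?add0r. Qed.

Lemma elemD p q : elem p *m elem q = elem (p + q).
Proof.
have [a1 a2 a3 a4] := elemE p; have [b1 b2 b3 b4] := elemE q.
have [c1 c2 c3 c4] := elemE (p + q).
by apply: mx2P; rewrite mulmx2E ?(a1, a2, a3, a4) ?(b1, b2, b3, b4);
  rewrite ?(c1, c2, c3, c4); ring.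
Qed.

Lemma elem0 : elem 0 = 1%:M.
Proof. by rewrite /elem scale0r addr0. Qed.

Lemma elem_conjE p C (B := elem p *m C *m elem (- p)) :
  [/\ B 0 0 = C 0 0 + p * C 1 0, B 1 0 = C 1 0, B 1 1 = C 1 1 - p * C 1 0
    & B 0 1 = C 0 1 + p * C 1 1 - p * B 0 0].
Proof.
rewrite {}/B.
have [[a1 a2 a3 a4] [b1 b2 b3 b4]] := conj (elemE p) (elemE (- p)).
by split; rewrite !mulmx2E ?(a1, a2, a3, a4) ?(b1, b2, b3, b4); ring.
Qed.

(** Cramer's rule, the determinant being a unit, that is, a nonzero constant. *)
Lemma inv2E V W : V *m W = 1%:M ->
  exists2 c : K, c != 0 &
    W 0 0 * W 1 1 - W 0 1 * W 1 0 = c%:P /\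
    [/\ W 0 0 = c%:P * V 1 1, W 0 1 = - (c%:P * V 0 1),
        W 1 0 = - (c%:P * V 1 0) & W 1 1 = c%:P * V 0 0].
Proof.
move=> VW.
have E i j : V i 0 * W 0 j + V i 1 * W 1 j = (i == j)%:R.
  by rewrite -mulmx2E VW mxE.
have [e00 e01 e10 e11] := And4 (E 0 0) (E 0 1) (E 1 0) (E 1 1).
rewrite /= in e00 e01 e10 e11.
(* the determinants are mutually inverse; each entry of W is recovered by
   multiplying the equations of V W = 1 by entries of W *)
pose d := W 0 0 * W 1 1 - W 0 1 * W 1 0.
pose e := V 0 0 * V 1 1 - V 0 1 * V 1 0.
have ed : e * d = 1.
  transitivity ((V 0 0 * W 0 0 + V 0 1 * W 1 0) * (V 1 0 * W 0 1 + V 1 1 * W 1 1)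
    - (V 0 0 * W 0 1 + V 0 1 * W 1 1) * (V 1 0 * W 0 0 + V 1 1 * W 1 0)).
    by rewrite /d /e; ring.
  by rewrite e00 e01 e10 e11 mulr0 subr0 mulr1.
have d0 : d != 0 by apply: contra_eq_neq ed => ->; rewrite mulr0 eq_sym oner_neq0.
have e0 : e != 0 by apply: contra_eq_neq ed => ->; rewrite mul0r eq_sym oner_neq0.
have sd : (size d <= 1)%N.
  have := size_mul e0 d0; rewrite ed size_poly1.
  by move: e0; rewrite -size_poly_eq0; move: (size e) (size d) => se sd; lia.
have dE := size1_polyC sd; exists d`_0.
  by apply: contraNneq d0 => c0; rewrite dE c0.
rewrite -dE; split=> //.
have WV00 : d * V 0 0 = W 1 1 * (V 0 0 * W 0 0 + V 0 1 * W 1 0)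
    - W 1 0 * (V 0 0 * W 0 1 + V 0 1 * W 1 1) by rewrite /d; ring.
have WV01 : d * V 0 1 = W 0 0 * (V 0 0 * W 0 1 + V 0 1 * W 1 1)
    - W 0 1 * (V 0 0 * W 0 0 + V 0 1 * W 1 0) by rewrite /d; ring.
have WV10 : d * V 1 0 = W 1 1 * (V 1 0 * W 0 0 + V 1 1 * W 1 0)
    - W 1 0 * (V 1 0 * W 0 1 + V 1 1 * W 1 1) by rewrite /d; ring.
have WV11 : d * V 1 1 = W 0 0 * (V 1 0 * W 0 1 + V 1 1 * W 1 1)
    - W 0 1 * (V 1 0 * W 0 0 + V 1 1 * W 1 0) by rewrite /d; ring.
rewrite WV00 WV01 WV10 WV11 e00 e01 e10 e11.
by rewrite !mulr0 !mulr1 ?subr0 ?sub0r ?opprK.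
Qed.

(** If C exceeds the bound N of both ends, let M be its degree, at least N.  With m
    the degree of W, reached in the corner (1, 0), the entry (1, 0) of the
    conjugate of C by the inverse of W has in degree 2m + M the coefficient of
    degree M of C 0 1 times a nonzero constant; so C 0 1 has no term of degree M,
    nor has C 1 0, which the transvection does not change.  Then p * C 0 0 and
    p * C 1 1 are combinations of terms of degree below deg p + M, so the
    diagonal has no term of degree M either. *)
Lemma peak_step C V W p m N M :
  V *m W = 1%:M -> p != 0 -> (size (W 0%R 0%R) <= m)%N -> size (W 1%R 0%R) = m.+1 ->
  bounded N (V *m C *m W) -> bounded N (elem p *m C *m elem (- p)) ->
  (N <= M)%N -> bounded M.+1 C -> bounded M C.
Proof.
move=> VW p0 sW00 sW10 bA bB leNM bC.
have [c c0 [_ [wv00 _ wv10 _]]] := inv2E VW.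
have sC a : a != 0 -> forall q, size (a%:P * q) = size q.
  by move=> a0 q; rewrite mul_polyC size_scale.
have sV10 : size (V 1%R 0%R) = m.+1 by rewrite -sW10 wv10 size_polyN sC.
have sV11 : (size (V 1%R 1%R) <= m)%N by rewrite -(sC c c0) -wv00.
have b0 : (C 0 1)`_M = 0.
  pose X := V 1 0 * C 0 0 + V 1 1 * C 1 0.
  pose Y := V 1 0 * C 0 1 + V 1 1 * C 1 1.
  have szV i j : (size (V 1%R i * C i j)%R <= (m + M).+1)%N.
    apply: (@size_leqM _ _ m M.+1); rewrite ?addnS //.
    by move: i; apply: ord2P; rewrite ?sV10 // leqW.
  have sX : (size X <= (m + M).+1)%N by apply: size_leqD; apply: szV.
  have sY : (size Y <= (m + M).+1)%N by apply: size_leqD; apply: szV.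
  have : (X * W 0 0 + Y * W 1 0)`_(m + M + m) = 0.
    rewrite nth_default //; have := bA 1 0; rewrite !mulmx2E => /leq_trans; apply.
    by rewrite (leq_trans leNM) // addnAC leq_addl.
  (* only [V 1 0 * C 0 1 * W 1 0] reaches this degree *)
  rewrite coefD nth_default ?(size_leqM sX sW00) // add0r coef_top ?sW10 //.
  rewrite /Y coefD coef_top ?sV10 // [X in _ + X]nth_default; last first.
    by apply: leq_trans (size_polyMleq _ _) _; have := bC 1 1; move: sV11; lia.
  have top q : size q = m.+1 -> q`_m != 0.
    move=> sq; rewrite -[m]/(m.+1.-1) -sq -lead_coefE lead_coef_eq0.
    by rewrite -size_poly_eq0 sq.
  move/eqP; rewrite addr0 !mulf_eq0 (negPf (top _ sV10)) (negPf (top _ sW10)).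
  by rewrite orbF => /eqP.
have [B00 B10 B11 B01] := elem_conjE p C.
set B := elem p *m C *m elem (- p) in bB B00 B10 B11 B01.
have bBM i j : (size (B i j) <= M)%N := leq_trans (bB i j) leNM.
have sb : (size (C 0%R 1%R) <= M)%N by apply: size_le_coef0 (bC _ _) b0.
have [k sp] : exists k, size p = k.+1.
  by exists (size p).-1; rewrite prednK // size_poly_gt0.
have pM i j : (size (p * B i j)%R <= k + M)%N.
  by apply: (@size_leqM _ _ k M); rewrite ?sp.
have kM i j : (size (B i j) <= k + M)%N by rewrite (leq_trans (bBM i j)) ?leq_addl.
have kb : (size (C 0%R 1%R) <= k + M)%N by rewrite (leq_trans sb) ?leq_addl.
have sa : (size (C 0%R 0%R) <= M)%N.
  apply: (size_mul_cancel sp).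
  have -> : p * C 0 0 = C 0 1 + p * B 1 1 - B 0 1 by rewrite B01 B00 B11; ring.
  by apply: size_leqB => //; apply: size_leqD.
have sd : (size (C 1%R 1%R) <= M)%N.
  apply: (size_mul_cancel sp).
  have -> : p * C 1 1 = B 0 1 - C 0 1 + p * B 0 0 by rewrite B01 B00; ring.
  by apply: size_leqD => //; apply: size_leqB.
by do 2!apply: ord2P => //; rewrite -B10.
Qed.

Lemma ex_bounded A : exists n, bounded n A.
Proof.
exists (size (A 0%R 0%R) + size (A 0%R 1%R) + size (A 1%R 0%R) + size (A 1%R 1%R))%N.
by do 2!apply: ord2P; lia.
Qed.

(** C is the matrix between the two factors of the conjugator elem p * W. *)
Lemma peak_reduction C V W p m N :
  V *m W = 1%:M -> p != 0 -> (size (W 0%R 0%R) <= m)%N -> size (W 1%R 0%R) = m.+1 ->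
  bounded N (V *m C *m W) -> bounded N (elem p *m C *m elem (- p)) ->
  bounded N C.
Proof.
move=> VW p0 sW00 sW10 bA bB.
have [k] : exists k, bounded (N + k) C.
  have [k bC] := ex_bounded C; exists k => i j.
  exact: leq_trans (bC i j) (leq_addl _ _).
elim: k => [|k IH]; first by rewrite addn0.
rewrite addnS => bC; apply: IH.
by apply: (peak_step VW p0 sW00 sW10 bA bB _ bC); rewrite leq_addr.
Qed.
End PeakReduction.

(** * Chains of conjugations through matrices of bounded degree *)

Section Chains.
Local Open Scope ring_scope.
Variable K : fieldType.
Implicit Types (p q : {poly K}) (A B C U V W : 'M[{poly K}]_2).

(** The inverse is carried along because the search has to bound it too. *)
Definition conj_by s A B := exists U V,
  [/\ U *m V = 1%:M, bounded s U, bounded s V & B = U *m A *m V].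

(** Conjugators of size N.+1 leave room for transvections with entry bounded by N,
    and for constant matrices when N = 0. *)
Inductive chain N : 'M[{poly K}]_2 -> 'M[{poly K}]_2 -> Prop :=
| ChainRefl A : bounded N A -> chain N A A
| ChainStep A B C : bounded N A -> conj_by N.+1 A B -> chain N B C -> chain N A C.

Lemma chain_trans N A B C : chain N A B -> chain N B C -> chain N A C.
Proof. by elim=> // {}A B' D bA AB' _ IH /IH; apply: ChainStep. Qed.

Lemma chain1 N A B : bounded N A -> bounded N B -> conj_by N.+1 A B -> chain N A B.
Proof. by move=> bA bB AB; apply: ChainStep bA AB _; apply: ChainRefl. Qed.

Lemma bounded_leq m n A : (m <= n)%N -> bounded m A -> bounded n A.
Proof. by move=> le_mn bA i j; apply: leq_trans (bA i j) le_mn. Qed.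

Lemma boundedM a b c A B : bounded a.+1 A -> bounded b B -> (a + b <= c)%N ->
  bounded c (A *m B).
Proof.
move=> bA bB le_c i j; rewrite mulmx2E; apply: size_leqD.
  exact: size_leqM (bA _ _) (bB _ _) le_c.
exact: size_leqM (bA _ _) (bB _ _) le_c.
Qed.

Lemma bounded_inv n U V : U *m V = 1%:M -> bounded n U -> bounded n V.
Proof.
move=> UV bU; have [c c0 [_ [e00 e01 e10 e11]]] := inv2E UV.
have sC q : size (c%:P * q) = size q by rewrite mul_polyC size_scale.
by do 2!apply: ord2P; rewrite ?(e00, e01, e10, e11) ?size_polyN sC.
Qed.

Lemma chain_const N U V A : U *m V = 1%:M -> bounded 1 U -> bounded N A ->
  bounded N (U *m A *m V) /\ chain N A (U *m A *m V).
Proof.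
move=> UV bU bA; have bV := bounded_inv UV bU.
have bB : bounded N (U *m A *m V).
  move: bA; case: N => [|N] bA.
    move=> i j; have -> : A = 0.
      apply/matrixP => k l; rewrite mxE; apply/eqP.
      by rewrite -size_poly_eq0 -leqn0; apply: bA.
    by rewrite mulmx0 mul0mx mxE size_poly0.
  apply: (boundedM (a := N) (b := 1) _ bV); last by rewrite addn1.
  exact: boundedM bU bA _.
split=> //; apply: chain1 => //; exists U, V.
by split=> //; [apply: bounded_leq bU | apply: bounded_leq bV].
Qed.

Lemma elemV p : elem p *m elem (- p) = 1%:M.
Proof. by rewrite elemD subrr elem0. Qed.

Lemma bounded_elem n p : (size p <= n)%N -> bounded n.+1 (elem p).
Proof.
move=> sp; have [e00 e01 e10 e11] := elemE p.
by do 2!apply: ord2P; rewrite ?(e00, e01, e10, e11) ?size_poly1 ?size_poly0 // leqW.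
Qed.

(** A transvection between two bounded matrices is bounded unless it commutes with
    them: otherwise p times a nonzero entry, or times the difference of the
    diagonal entries, is a difference of bounded entries. *)
Lemma chain_elem N p C : bounded N C -> bounded N (elem p *m C *m elem (- p)) ->
  chain N C (elem p *m C *m elem (- p)).
Proof.
move=> bC bB; have [B00 B10 B11 B01] := elem_conjE p C.
set B := elem p *m C *m elem (- p) in bB B00 B10 B11 B01 *.
have small q : q != 0 -> (size (p * q)%R <= N)%N -> chain N C B.
  move=> q0; have [p0 _ | p0 spq] := eqVneq p 0.
    rewrite /B p0 oppr0 elem0 mul1mx mulmx1; exact: ChainRefl.
  apply: chain1 => //; exists (elem p), (elem (- p)).
  have sp : (size p <= N)%N.
    move: (q0) spq; rewrite size_mul // -size_poly_eq0.
    by move: (size p) (size q) => a b; lia.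
  by split; rewrite ?elemV //; apply: bounded_elem; rewrite ?size_polyN.
have [c0 | c0] := eqVneq (C 1 0) 0; last first.
  apply: (small _ c0); rewrite (_ : _ * _ = B 0 0 - C 0 0); last by rewrite B00; ring.
  exact: size_leqB.
rewrite c0 mulr0 addr0 in B00; rewrite c0 mulr0 subr0 in B11.
have [ad | ad] := eqVneq (C 1 1 - C 0 0) 0; last first.
  apply: (small _ ad); rewrite (_ : _ * _ = B 0 1 - C 0 1).
    exact: size_leqB.
  by rewrite B01 B00; ring.
rewrite (_ : B = C); first exact: ChainRefl.
apply: mx2P => //; rewrite B01 B00; move/subr0_eq: ad => ->; ring.
Qed.

(** Division of the first row by the second in column 0.  The determinant is a
    constant, so the other column follows: its degrees cannot exceed those in
    column 0. *)
Lemma euclid_step n U V :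
  U *m V = 1%:M -> bounded n.+2 U -> size (U 0 0) = n.+2 ->
  (size (U 1 0)%R <= n.+1)%N ->
  exists p m (W := elem (- p) *m U), [/\ p != 0, bounded n.+1 W,
    (size (W 0 0)%R <= m)%N & size (W 1 0) = m.+1].
Proof.
move=> UV bU s00 s10; have VU := mulmx1C UV.
have [c c0 [dU _]] := inv2E VU.
have U10 : U 1 0 != 0.
  apply: contra_eq_neq s00 => u10; move: dU; rewrite u10 mulr0 subr0.
  have [-> | u00 ] := eqVneq (U 0 0) 0; first by rewrite size_poly0.
  have [-> | u11 ] := eqVneq (U 1 1) 0.
    by rewrite mulr0 => /esym/eqP; rewrite polyC_eq0 (negPf c0).
  move/(congr1 (size \o val)) => /=; rewrite size_mul // size_polyC c0.
  by move: u11; rewrite -size_poly_eq0; move: (size _) (size _) => a b; lia.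
pose p := U 0 0 %/ U 1 0; have [e00 e01 e10 e11] := elemE (- p).
have [m s10E] : exists m, size (U 1 0) = m.+1.
  by exists (size (U 1 0)).-1; rewrite prednK // size_poly_gt0.
pose W := elem (- p) *m U.
have w1 j : W 1 j = U 1 j by rewrite mulmx2E e10 e11 mul0r add0r mul1r.
have w0 j : W 0 j = U 0 j - p * U 1 j by rewrite mulmx2E e00 e01 mul1r mulNr.
have w00 : (size (W 0 0)%R <= m)%N.
  rewrite w0 (_ : _ - _ = U 0 0 %% U 1 0).
    by rewrite -ltnS -s10E ltn_modpN0.
  by rewrite {1}(divp_eq (U 0 0) (U 1 0)) addrAC subrr add0r.
have sc : (size (c%:P)%R <= 1)%N by apply: size_polyC_leq1.
have u11 : (size (U 1 1)%R <= m.+1)%N.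
  apply: (size_mul_cancel s00).
  have -> : U 0 0 * U 1 1 = c%:P + U 0 1 * U 1 0 by rewrite -dU subrK.
  apply: size_leqD; first by apply: leq_trans sc _; lia.
  by apply: (@size_leqM _ _ _ n.+1 m.+1); rewrite ?s10E.
have dW : W 0 0 * W 1 1 - W 0 1 * W 1 0 = c%:P by rewrite !w0 !w1 -dU; ring.
have w01 : (size (W 0 1)%R <= m.+1)%N.
  apply: (@size_mul_cancel _ (W 1 0) _ m); first by rewrite w1.
  have -> : W 1 0 * W 0 1 = W 1 1 * W 0 0 - c%:P by rewrite -dW; ring.
  apply: size_leqB; last by apply: leq_trans sc _; lia.
  by apply: (@size_leqM _ _ _ m m); rewrite // ?w1 //; lia.
exists p, m; split=> //; last by rewrite w1.
  apply: contra_eq_neq s00 => p0; move: w00; rewrite w0 p0 mul0r subr0.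
  by move: s10; rewrite s10E; move: (size _) => a; lia.
apply: (@bounded_leq m.+1); first by rewrite -s10E.
do 2!apply: ord2P => //; rewrite ?w1 ?s10E //; exact: leqW.
Qed.

End Chains.

Section Descent.
Local Open Scope ring_scope.
Variable K : fieldType.
Implicit Types (p q : {poly K}) (A B C G H U V W : 'M[{poly K}]_2).

(** The permutation matrix that exchanges the indices 0 and i. *)
Definition swap (i : 'I_2) : 'M[{poly K}]_2 := if i == 0 then 1%:M else tperm_mx 0 1.

Lemma swapK i : swap i *m swap i = 1%:M.
Proof.
rewrite /swap; case: eqP => _; first by rewrite mulmx1.
by rewrite /tperm_mx -perm_mxM tperm2 perm_mx1.
Qed.

Lemma bounded1 : bounded 1 (1%:M : 'M[{poly K}]_2).
Proof. by move=> i j; rewrite mxE; case: eqP; rewrite ?size_poly1 ?size_poly0. Qed.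

Lemma bounded_swap i : bounded 1 (swap i).
Proof.
rewrite /swap; case: eqP => _; first exact: bounded1.
by move=> j k; rewrite !mxE; case: eqP; rewrite ?size_poly1 ?size_poly0.
Qed.

Lemma swapE i j U : (swap i *m U *m swap j) 0 0 = U i j.
Proof.
have e k : (swap k 0 0 = (k == 0)%:R) * (swap k 0 1 = (k == 1)%:R)
  * (swap k 1 0 = (k == 1)%:R).
  move: k; apply: ord2P; rewrite /swap /= !mxE //=.
  by rewrite ?tpermL ?tpermR.
by rewrite !mulmx2E !e; move: i j; apply: ord2P; apply: ord2P;
  rewrite /= ?mul0r ?mulr0 ?mul1r ?mulr1 ?addr0 ?add0r.
Qed.

(** A constant row operation removes the leading term of the entry (1, 0), which
    prepares the division with remainder. *)
Lemma top_corner n U : bounded n.+2 U ->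
  (U 0 0)`_n.+1 != 0 ->
  exists G H, [/\ G *m H = 1%:M, bounded 1 G, size ((G *m U) 0 0) = n.+2,
    (size ((G *m U) 1 0)%R <= n.+1)%N & bounded n.+2 (G *m U)].
Proof.
move=> bU u0; pose l := - ((U 1 0)`_n.+1 / (U 0 0)`_n.+1).
pose G : 'M[{poly K}]_2 := 1%:M + l%:P *: delta_mx 1 0.
pose H : 'M[{poly K}]_2 := 1%:M - l%:P *: delta_mx 1 0.
have [g00 g01 g10 g11] : [/\ G 0 0 = 1, G 0 1 = 0, G 1 0 = l%:P & G 1 1 = 1].
  by split; rewrite !mxE /= ?mulr0 ?mulr1 ?addr0 ?add0r.
have bG : bounded 1 G.
  by do 2!apply: ord2P; rewrite ?(g00, g01, g10, g11);
    rewrite ?size_poly1 ?size_poly0 ?size_polyC_leq1.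
have bGU : bounded n.+2 (G *m U) by apply: boundedM bG bU _.
exists G, H; split=> //.
- rewrite /G /H mulmxDl mul1mx mulmxBr mulmx1 -scalemxAl -scalemxAr mul_delta_mx_0 //.
  by rewrite !scaler0 subr0 subrK.
- rewrite mulmx2E g00 g01 mul1r mul0r addr0; apply/eqP; rewrite eqn_leq bU /=.
  by rewrite ltnNge; apply: contra u0 => s0; rewrite nth_default.
apply: (size_le_coef0 (bGU 1 0)); rewrite mulmx2E g10 g11 mul1r coefD coefCM.
by rewrite /l mulNr divfK // addNr.
Qed.

Lemma conjmxM G U A V H :
  G *m U *m A *m (V *m H) = G *m (U *m A *m V) *m H.
Proof. by rewrite !mulmxA. Qed.

Lemma mulmx_inv G H U V : G *m H = 1%:M -> U *m V = 1%:M ->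
  G *m U *m (V *m H) = 1%:M.
Proof. by move=> GH UV; rewrite mulmxA -[G *m U *m V]mulmxA UV mulmx1. Qed.

Lemma conjmxK U V A : V *m U = 1%:M -> V *m (U *m A *m V) *m U = A.
Proof. by move=> VU; rewrite !mulmxA VU mul1mx -mulmxA VU mulmx1. Qed.

Lemma chain_const_inv N G H A : G *m H = 1%:M -> bounded 1 G ->
  bounded N A -> bounded N (G *m A *m H) /\ chain N (G *m A *m H) A.
Proof.
move=> GH bG bA; have HG := mulmx1C GH.
have [bB _] := chain_const GH bG bA; split=> //.
have [_] := chain_const HG (bounded_inv GH bG) bB.
by rewrite conjmxK.
Qed.

(** One step of the descent: the remainder matrix W conjugates A to a matrix that is
    bounded by peak reduction, and W has smaller degree. *)
Lemma chain_euclid n N U V A :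
    (forall W V', W *m V' = 1%:M -> bounded n.+1 W ->
       bounded N (W *m A *m V') -> chain N A (W *m A *m V')) ->
  U *m V = 1%:M -> bounded n.+2 U -> size (U 0 0) = n.+2 ->
  (size (U 1 0)%R <= n.+1)%N -> bounded N A -> bounded N (U *m A *m V) ->
  chain N A (U *m A *m V).
Proof.
move=> IH UV bU s00 s10 bA bB.
have [p [m [p0 bW w00 w10]]] := euclid_step UV bU s00 s10.
have eV := elemV p; have Ve := mulmx1C eV.
have WV := mulmx_inv Ve UV; have CE := conjmxM (elem (- p)) U A V (elem p).
set W := elem (- p) *m U in bW w00 w10 WV CE; set V' := V *m elem p in WV CE.
have BE : elem p *m (W *m A *m V') *m elem (- p) = U *m A *m V.
  by rewrite CE conjmxK.
have bC : bounded N (W *m A *m V').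
  apply: (peak_reduction (mulmx1C WV) p0 w00 w10); last by rewrite BE.
  by rewrite (conjmxK _ (mulmx1C WV)).
apply: (chain_trans (IH _ _ WV bW bC)).
by rewrite -BE; apply: chain_elem; rewrite // BE.
Qed.

(** Induction on the degree of the conjugator; permuting rows and columns puts an
    entry of top degree in the corner where the division starts. *)
Lemma chain_conj n N U V A : U *m V = 1%:M -> bounded n.+1 U ->
  bounded N A -> bounded N (U *m A *m V) -> chain N A (U *m A *m V).
Proof.
elim: n U V A => [|n IH] U V A UV bU bA bB.
  by have [] := chain_const UV bU bA.
have [/forallP h | ] := boolP [forall i, forall j, (U i j)`_n.+1 == 0].
  apply: IH => // i j; apply: size_le_coef0 => //.
  exact/eqP/(forallP (h i)).
move=> /forallPn[i /forallPn[j Uij]].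
have [si sj] := (swapK i, swapK j); have bs := @bounded_swap.
have [bA1 AA1] := chain_const sj (bs j) bA.
have [bB1 B1B] := chain_const_inv si (bs i) bB.
apply: (chain_trans AA1); apply: chain_trans B1B.
have UV1 : (swap i *m U *m swap j) *m (swap j *m (V *m swap i)) = 1%:M.
  by apply: mulmx_inv sj; apply: mulmx_inv.
have bU1 : bounded n.+2 (swap i *m U *m swap j).
  apply: (@boundedM _ n.+1 1); rewrite ?addn1 //.
  exact: (@boundedM _ 0 n.+2).
have B1E : (swap i *m U *m swap j) *m (swap j *m A *m swap j) *m
    (swap j *m (V *m swap i)) = swap i *m (U *m A *m V) *m swap i.
  by rewrite conjmxM (conjmxK _ sj) conjmxM.
rewrite -{}B1E in bB1 *.
move: (swap j *m A *m swap j) (swap i *m U *m swap j) (swap j *m (V *m swap i))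
  (swapE i j U) bA1 UV1 bU1 bB1 => A1 U1 V1 U1E bA1 UV1 bU1 bB1.
have [|G [H [GH bG s00 s10 bGU]]] := top_corner bU1; first by rewrite U1E.
have [bB2 B2B1] := chain_const_inv GH bG bB1.
apply: chain_trans B2B1; rewrite -conjmxM in bB2 *.
apply: chain_euclid => //; last exact: mulmx_inv.
by move=> W V' WV' bW; apply: IH.
Qed.

End Descent.

(** * A bound on conjugators *)

Section Pigeonhole.
Local Open Scope ring_scope.
Variable F : finFieldType.
Implicit Types (A B U V : 'M[{poly F}]_2).

Definition encode N A : 'M['rV[F]_N]_2 := map_mx poly_rV A.
Definition decode N (X : 'M['rV[F]_N]_2) : 'M[{poly F}]_2 := map_mx rVpoly X.

Lemma encodeK N A : bounded N A -> decode (encode N A) = A.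
Proof. by move=> bA; apply/matrixP => i j; rewrite !mxE poly_rV_K. Qed.

Lemma bounded_decode N (X : 'M['rV[F]_N]_2) : bounded N (decode X).
Proof. by move=> i j; rewrite mxE size_poly. Qed.

Definition conj_step N : rel 'M['rV[F]_N]_2 := fun X Y =>
  [exists U : 'M['rV[F]_N.+1]_2, exists V : 'M['rV[F]_N.+1]_2,
    (decode U *m decode V == 1%:M) && (decode Y == decode U *m decode X *m decode V)].

Definition conj_bound N := ((N.+1 * (#|F| ^ N) ^ 4).+1)%N.

Lemma chain_connect N A B :
  chain N A B -> connect (@conj_step N) (encode N A) (encode N B).
Proof.
suff: chain N A B -> bounded N A /\ connect (@conj_step N) (encode N A) (encode N B).
  by move=> H /H[].
elim=> {A B} [A bA | A B C bA [U [V [UV bU bV eB]]] _ [bB BC]]; split=> //.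
apply: connect_trans BC; apply: connect1.
apply/existsP; exists (encode _ U); apply/existsP; exists (encode _ V).
by rewrite !encodeK // UV eB !eqxx.
Qed.

Lemma path_conj N X s : path (@conj_step N) X s ->
  conj_by (N.+1 * size s).+1 (decode X) (decode (last X s)).
Proof.
elim: s X => [|Y s IH] X /=.
  exists 1%:M, 1%:M; rewrite !mulmx1 mul1mx muln0; split=> //; exact: bounded1.
case/andP=> /existsP[U /existsP[V /andP[/eqP UV /eqP eY]]].
move/IH => [U' [V' [UV' bU' bV' ->]]].
exists (U' *m decode U), (decode V *m V'); split.
- by rewrite mulmxA -[U' *m _ *m _]mulmxA UV mulmx1.
- by apply: boundedM bU' (bounded_decode _) _; rewrite mulnS addnC leqW.
- apply: boundedM (bounded_decode V) bV' _; by rewrite mulnS addnS.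
by rewrite eY !mulmxA.
Qed.

(** A path without repetitions has fewer steps than there are vertices, and degrees
    add up along it. *)
Lemma conj_by_bound N A B : bounded N A -> bounded N B ->
  (exists U V, U *m V = 1%:M /\ B = U *m A *m V) ->
  conj_by (conj_bound N) A B.
Proof.
move=> bA bB [U [V [UV eB]]].
have [n {}/(bounded_leq (leqnSn _)) bU] := ex_bounded U.
have := chain_conj UV bU bA; rewrite -eB => /(_ bB)/chain_connect/connectP[s0].
move=> /shortenP[s ps us _] eBs.
have := path_conj ps; rewrite -eBs !encodeK // => -[U' [V' [UV' bU' bV' ->]]].
have le_s : ((N.+1 * size s).+1 <= conj_bound N)%N.
  rewrite /conj_bound.
  have <- : #|{: 'M['rV[F]_N]_2}| = ((#|F| ^ N) ^ 4)%N by rewrite !card_mx mul1n.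
  rewrite ltnS leq_mul //; apply: ltnW.
  by have := max_card (mem (encode N A :: s)); rewrite (card_uniqP us).
by exists U', V'; split=> //; apply: bounded_leq le_s _.
Qed.
End Pigeonhole.

(** * The decision procedure *)

Lemma ltn_code_exp b s : all (fun a => a <= b) s ->
  CodeSeq.code s < 2 ^ (b.+1 * size s).
Proof.
elim: s => [|a s IH] /=; first by rewrite muln0.
case/andP=> le_ab /IH {IH}; set x := 2 ^ (_ * size s) => lt_cx.
rewrite [b.+1 * _]mulnS expnD expnS -mulnA mulnCA -/x.
apply: (@leq_ltn_trans (2 ^ b * (CodeSeq.code s).*2.+1)).
  by rewrite leq_mul2r leq_exp2l ?le_ab ?orbT.
by rewrite ltn_pmul2l ?expn_gt0 //; lia.
Qed.

Section Decision.
Variable F : finFieldType.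
Local Open Scope ring_scope.

Lemma poly_code_bound L (p : {poly F}) : (size p <= L)%N ->
  (poly_code p < 2 ^ (#|F|.+1 * L))%N.
Proof.
move=> sp; apply: (@leq_trans (2 ^ (#|F|.+1 * size p))); last first.
  by rewrite leq_exp2l // leq_mul2l sp orbT.
rewrite -(size_map (fun a : F => enum_rank a : nat)); apply: ltn_code_exp.
by apply/allP => _ /mapP[a _ ->]; apply: ltnW.
Qed.

(** The offset d selects one of the two matrices coded by w. *)
Definition mx_decode d w : 'M[{poly F}]_2 :=
  \matrix_(i, j) poly_decode F (nth 0%N (CodeSeq.decode w) (d + i * 2 + j)).

Definition mx_code (U V : 'M[{poly F}]_2) : nat :=
  CodeSeq.code (pair_code (U, V)).

Lemma mx_codeK U V : mx_decode 0 (mx_code U V) = U /\ mx_decode 4 (mx_code U V) = V.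
Proof.
by split; apply: mx2P; rewrite mxE /mx_code CodeSeq.codeK /= poly_codeK.
Qed.

Definition code_bound L := (2 ^ ((2 ^ (#|F|.+1 * L)).+1 * 8))%N.

Lemma mx_code_bound L U V : bounded L U -> bounded L V ->
  (mx_code U V < code_bound L)%N.
Proof.
move=> bU bV.
have small i j M : bounded L M -> (poly_code (M i j : {poly F}) <= 2 ^ (#|F|.+1 * L))%N.
  by move=> bM; apply/ltnW/poly_code_bound.
by apply: (@ltn_code_exp _ (pair_code (U, V))); rewrite /= !small.
Qed.

Lemma mx_computable_decode T n (env : T -> n.-tuple nat) d w :
  computable env w -> mx_computable env (fun x => mx_decode d (w x)).
Proof.
move=> cw i j; apply: eq_poly_computable (poly_computable_decode F
  (computable_nth_decode 0 cw (computable_const env (d + i * 2 + j)))) => x.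
by rewrite mxE.
Qed.

Lemma mx_computable_bound T n (env : T -> n.-tuple nat) (M : T -> 'M[{poly F}]_2) :
  mx_computable env M -> exists2 N, computable env N & forall x, bounded (N x) (M x).
Proof.
move=> cM; have [[s00 c00 b00] _] := cM 0 0; have [[s01 c01 b01] _] := cM 0 1.
have [[s10 c10 b10] _] := cM 1 0; have [[s11 c11 b11] _] := cM 1 1.
exists (fun x => s00 x + s01 x + (s10 x + s11 x))%N.
  by do 2?apply: computable_add.
move=> x; do 2!apply: ord2P.
- by apply: leq_trans (b00 x) _; lia.
- by apply: leq_trans (b01 x) _; lia.
- by apply: leq_trans (b10 x) _; lia.
by apply: leq_trans (b11 x) _; lia.
Qed.

Let env := @pair_code F.

Lemma mx_computable_pair : mx_computable env fst /\ mx_computable env snd.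
Proof.
have var i : computable env (fun x => tnth (env x) i) by exists (RProj i).
have entry k (f : _ -> {poly F}) : (forall x, tnth (env x) k = poly_code (f x)) ->
    poly_computable env f.
  move=> fE; apply: eq_poly_computable (poly_computable_decode F (var k)) => x.
  by rewrite fE poly_codeK.
split; do 2!apply: ord2P.
- by apply: (entry (inord 0)) => -[A B]; rewrite (tnth_nth 0%N) inordK.
- by apply: (entry (inord 1)) => -[A B]; rewrite (tnth_nth 0%N) inordK.
- by apply: (entry (inord 2)) => -[A B]; rewrite (tnth_nth 0%N) inordK.
- by apply: (entry (inord 3)) => -[A B]; rewrite (tnth_nth 0%N) inordK.
- by apply: (entry (inord 4)) => -[A B]; rewrite (tnth_nth 0%N) inordK.
- by apply: (entry (inord 5)) => -[A B]; rewrite (tnth_nth 0%N) inordK.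
- by apply: (entry (inord 6)) => -[A B]; rewrite (tnth_nth 0%N) inordK.
by apply: (entry (inord 7)) => -[A B]; rewrite (tnth_nth 0%N) inordK.
Qed.

(** The number w codes a conjugator together with its inverse, so that no test of
    invertibility is needed. *)
Definition certificate w (AB : 'M[{poly F}]_2 * 'M[{poly F}]_2) :=
  (mx_decode 0 w *m mx_decode 4 w == 1%:M)
  && (AB.2 == mx_decode 0 w *m AB.1 *m mx_decode 4 w).

Definition decide (N : 'M[{poly F}]_2 * 'M[{poly F}]_2 -> nat) AB :=
  has (fun w => certificate w AB) (iota 0 (code_bound (conj_bound F (N AB)))).

Lemma computable_decide N : computable env N -> computable env (decide N).
Proof.
move=> cN; have c := @computable_const _ _ env.
apply: (@computable_has _ _ env _ (fun p => certificate p.1 p.2)).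
  apply: computable_exp (c 2) (computable_mul (computable_succ _) (c 8)).
  apply: computable_exp (c 2) (computable_mul (c _) _).
  apply/computable_succ/computable_mul; first exact: computable_succ.
  by apply: computable_exp (c 4); apply: computable_exp cN.
have [cA cB] := mx_computable_pair.
have cdec d := mx_computable_decode d (computable_fst env).
apply: computable_and.
  exact: computable_mx_eq (mx_computableM (cdec 0) (cdec 4)) (mx_computable1 _ _).
apply: computable_mx_eq (mx_computable_snd cB) _.
exact: mx_computableM (mx_computableM (cdec 0) (mx_computable_snd cA)) (cdec 4).
Qed.

Lemma conj_GL2E (AB : 'M[{poly F}]_2 * 'M[{poly F}]_2) :
  conj_GL2 AB <-> exists U V, U *m V = 1%:M /\ AB.2 = U *m AB.1 *m V.
Proof.
split=> [[U uU ->] | [U [V [UV eB]]]]; first by exists U, (invmx U); rewrite mulmxV.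
have [uU _] := mulmx1_unit UV; exists U; rewrite ?{}eB //; congr (_ *m _).
by rewrite -[V]mul1mx -(mulVmx uU) -mulmxA UV mulmx1.
Qed.

Lemma decideP N AB : bounded (N AB) AB.1 -> bounded (N AB) AB.2 ->
  reflect (conj_GL2 AB) (decide N AB).
Proof.
move=> bA bB; apply: (iffP hasP) => [[w _ /andP[/eqP UV /eqP BE]] | ].
  by apply/conj_GL2E; exists (mx_decode 0 w), (mx_decode 4 w).
move/conj_GL2E/(conj_by_bound bA bB) => [U [V [UV bU bV BE]]].
exists (mx_code U V); first by rewrite mem_iota mx_code_bound.
by have [UK VK] := mx_codeK U V; rewrite /certificate UK VK UV -BE !eqxx.
Qed.

End Decision.

Theorem corollary1p2 (F : finFieldType) :
  effectively_solvable (@in_GL2 F) (@conj_GL2 F) (@pair_code F).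
Proof.
have [cA cB] := mx_computable_pair F.
have [N cN bN] := mx_computable_bound cA; have [M cM bM] := mx_computable_bound cB.
pose NM x := (N x + M x)%N.
have [f fP] := computable_decide (computable_add cN cM).
exists f => AB _.
have dP : reflect (conj_GL2 AB) (decide NM AB).
  by apply: decideP; [apply: bounded_leq (bN AB) | apply: bounded_leq (bM AB)];
    rewrite ?leq_addr ?leq_addl.
have := fP AB; rewrite -[decide _ AB]/(decide NM AB) => fAB.
by split=> [/dP E | /dP/negbTE E]; rewrite E in fAB.
Qed.
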